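(* Let $X=\{v_1,\dots,v_n\}$ be a finite set with at least three points and a fixed labelling. Then the clustering algorithm \texttt{SiR-Morse} on $X$ satisfies Monotonic Consistency: for every distance $d$ on $X$, if $\mathcal{P}$ is the partition returned by \texttt{SiR-Morse} on $(X,d)$ and $d'$ is a $\mathcal{P}$-monotonic transformation of $d$, then \texttt{SiR-Morse} on $(X,d')$ also returns $\mathcal{P}$.
   Context: A distance on $X$ is a function $d\colon X\times X\to\mathbb{R}$ with $d(i,j)=d(j,i)\ge 0$ and $d(i,j)=0$ if and only if $i=j$ (no triangle inequality required). For a partition $\mathcal{P}$, $x\sim_{\mathcal{P}}y$ means $x,y$ lie in the same cluster of $\mathcal{P}$. Monotonic transformations. A map $\eta\colon[0,\infty)\to[0,\infty)$ is expansive if it is continuous and $|\eta(x)-\eta(y)|\ge|x-y|$ for all $x,y$; if moreover $\eta(0)=0$ it is a bijection. A $\mathcal{P}$-monotonic transformation of $d$ is any distance $d'$ on $X$ such that, for some expansive $\eta\colon[0,\infty)\to[0,\infty)$ (necessarily with $\eta(0)=0$) and all $x,y\in X$: $d(x,y)=\eta(d'(x,y))$ if $x\sim_{\mathcal{P}}y$, and $d(x,y)=\eta^{-1}(d'(x,y))$ if $x\not\sim_{\mathcal{P}}y$. Morse clustering. Let $\mathcal{G}=(V,E)$ be a finite graph, $E\subseteq V\times V$, with a preorder $\preceq_E$ on edges and a preorder $\preceq_V$ on vertices ($a\prec b$ means $a\preceq b$ and not $b\preceq a$). Let $E_v=\{(v,w)\in E\}$; a maximal edge at $v$ is an $e\in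 E_v$ with $f\preceq_E e$ for all $f\in E_v$. The Morse flow is $\Phi\colon V\to V$ with $\Phi(v)=w$ if $(v,w)$ is the unique maximal edge at $v$ and $v\prec_V w$, and $\Phi(v)=v$ otherwise. The Morse clustering is the partition of $V$ into connected components (ignoring directions) of the graph on $V$ with edges $(v,\Phi(v))$ for all $v$ with $\Phi(v)\ne v$. \texttt{SiR-Morse} applied to $(X,d)$ is Morse clustering on the complete graph with vertex set $X$ (edges $(v,w)$ for all $v\neq w$), with $v_i\preceq_V v_j$ iff $i\le j$, and, for edges at the same vertex $v$, $(v,w)\preceq_E(v,t)$ iff $d(v,w)\ge d(v,t)$. *)

(* Defs.v *)
From mathcomp Require Import all_boot all_order all_algebra.
From mathcomp Require Import all_classical all_reals all_analysis.
Set Implicit Arguments.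
Unset Strict Implicit.
Unset Printing Implicit Defensive.

Import Order.TTheory GRing.Theory Num.Theory.
Import numFieldNormedType.Exports.

Local Open Scope ring_scope.

(* The triangle inequality is deliberately not required. *)
Definition is_distance (R : realType) (X : Type) (d : X -> X -> R) : Prop :=
  [/\ forall x y, d x y = d y x,
      forall x y, 0 <= d x y
    & forall x y, d x y = 0 <-> x = y].

Definition same_cluster (X : finType) (P : {set {set X}}) (x y : X) : bool :=
  [exists C in P, (x \in C) && (y \in C)].

(* A map [0, +oo[ -> [0, +oo[ is represented by a function R -> R, of which   *)
(* only the values on [0, +oo[ matter.                                        *)
Definition expansive (R : realType) (eta : R -> R) : Prop :=
  [/\ {homo eta : x / 0 <= x},
      {within `[(0 : R), +oo[, continuous eta}%classic
    & forall x y : R, 0 <= x -> 0 <= y -> `|x - y| <= `|eta x - eta y|].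

(* P is meant to be a partition of the nonempty type X. The same-cluster       *)
(* condition at x = y then yields eta 0 = 0, so that eta is a bijection of     *)
(* [0, +oo[ and the default value 0 of its partial inverse is never used.      *)
Definition monotonic_transformation (R : realType) (X : finType)
    (P : {set {set X}}) (d d' : X -> X -> R) : Prop :=
  is_distance d' /\
  exists2 eta : R -> R, expansive eta &
    forall x y,
      (same_cluster P x y -> d x y = eta (d' x y)) /\
      (~~ same_cluster P x y ->
         d x y = 'pinv_(fun=> 0) `[(0 : R), +oo[%classic eta (d' x y)).

Definition monotonic_consistency (R : realType) (X : finType)
    (alg : (X -> X -> R) -> {set {set X}}) : Prop :=
  forall d, is_distance d ->
  forall d', monotonic_transformation (alg d) d d' -> alg d' = alg d.

Record morse_graph (V : finType) := MorseGraph {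
  edges : {set V * V};
  le_edge : rel (V * V);
  le_vertex : rel V;
  le_edge_refl : {in edges, reflexive le_edge};
  le_edge_trans : {in edges & &, transitive le_edge};
  le_vertex_refl : reflexive le_vertex;
  le_vertex_trans : transitive le_vertex
}.

Section MorseClustering.
Variables (V : finType) (G : morse_graph V).

Definition lt_vertex (a b : V) : bool := le_vertex G a b && ~~ le_vertex G b a.

Definition edges_at (v : V) : {set V * V} := [set e in edges G | e.1 == v].

Definition maximal_edge (v : V) (e : V * V) : bool :=
  (e \in edges_at v) && [forall f in edges_at v, le_edge G f e].

Definition unique_maximal_edge (v : V) (e : V * V) : bool :=
  maximal_edge v e && [forall f, maximal_edge v f ==> (f == e)].

(* At most one w satisfies the condition under pick. *)
Definition morse_flow (v : V) : V :=
  if [pick w | unique_maximal_edge v (v, w) && lt_vertex v w] is Some w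
  then w else v.

Definition flow_edge : rel V :=
  [rel v w | (morse_flow v != v) && (morse_flow v == w)].

Definition morse_clustering : {set {set V}} :=
  equivalence_partition
    (connect [rel v w | flow_edge v w || flow_edge w v]) [set: V].

End MorseClustering.

Section SiRMorse.
Variables (R : realType) (X : finType) (n : nat).
(* lab x is the index i such that x = v_i. *)
Variables (lab : X -> 'I_n) (d : X -> X -> R).

Definition sir_edges : {set X * X} := [set e | e.1 != e.2].

(* Edges at different vertices are incomparable. *)
Definition sir_le_edge : rel (X * X) :=
  [rel e f | (e.1 == f.1) && (d e.1 e.2 >= d f.1 f.2)].

Definition sir_le_vertex : rel X := [rel x y | (lab x <= lab y)%N].

Lemma sir_le_edge_refl : {in sir_edges, reflexive sir_le_edge}.
Proof. by move=> e _; apply/andP; split. Qed.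

Lemma sir_le_edge_trans : {in sir_edges & &, transitive sir_le_edge}.
Proof.
move=> f e g _ _ _ /andP[/eqP ef fe] /andP[/eqP fg gf].
by apply/andP; split; [rewrite ef fg | exact: le_trans gf fe].
Qed.

Lemma sir_le_vertex_refl : reflexive sir_le_vertex.
Proof. by move=> x; apply: leqnn. Qed.

Lemma sir_le_vertex_trans : transitive sir_le_vertex.
Proof. by move=> y x z /=; apply: leq_trans. Qed.

Definition sir_graph : morse_graph X :=
  MorseGraph sir_le_edge_refl sir_le_edge_trans
             sir_le_vertex_refl sir_le_vertex_trans.

Definition sir_morse : {set {set X}} := morse_clustering sir_graph.

End SiRMorse.

(* Main.v *)
(** Monotonic transformations pull points of the same cluster together and push
    points of different clusters apart, so a flow edge of [d], which stays inside
    a cluster, is still a flow edge of [d'].  Conversely, the flow increases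
    labels, hence a fixed point [v] of the flow of [d] is the vertex of largest
    label in its cluster.  A new edge [v -> w] of the flow of [d'] would thus leave
    the cluster of [v], and as [d v w] was expanded to [d' v w], the vertex [w]
    would already have been the unique nearest neighbour of [v] for [d].  So the
    two flows coincide. *)
Require Import Defs.
From mathcomp Require Import all_boot all_order all_algebra.
From mathcomp Require Import all_classical all_reals all_analysis.
Set Implicit Arguments.
Unset Strict Implicit.
Unset Printing Implicit Defensive.

Import Order.TTheory GRing.Theory Num.Theory.
Import numFieldNormedType.Exports.

Local Open Scope ring_scope.

Section Expansive.
Variables (R : realType) (eta : R -> R).
Hypotheses (eta_exp : expansive eta) (eta0 : eta 0 = 0).

Lemma expansive_ge x : 0 <= x -> x <= eta x.
Proof.
have [eta_ge0 _ eta_dist] := eta_exp.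
move=> x0; have := eta_dist x 0 x0 (lexx _).
by rewrite eta0 !subr0 !ger0_norm ?eta_ge0.
Qed.

Lemma expansive_inj x y : 0 <= x -> 0 <= y -> eta x = eta y -> x = y.
Proof.
have [_ _ eta_dist] := eta_exp.
move=> x0 y0 exy; have := eta_dist x y x0 y0.
by rewrite exy subrr normr0 normr_le0 subr_eq0 => /eqP.
Qed.

(** Since [eta 0 = 0], this is the intermediate value theorem on [[0, x]]. It serves both
    monotonicity and surjectivity of [eta]. *)
Lemma expansive_ivt x v : 0 <= x -> 0 <= v <= eta x ->
  exists2 c, 0 <= c <= x & eta c = v.
Proof.
have [eta_ge0 eta_cont _] := eta_exp.
move=> x0 v_itv; have [||c] := @IVT R eta 0 x v x0.
- by apply: continuous_subspaceW eta_cont; exact: subset_itvl.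
- by rewrite eta0 min_l ?max_r ?eta_ge0.
- by rewrite in_itv /= => c_itv <-; exists c.
Qed.

(** If [a < b] but [eta b <= eta a], then [eta b] is already attained at some [c <= a], and
    injectivity forces [c = b]. *)
Lemma expansive_lt x y : 0 <= x -> 0 <= y -> (eta x < eta y) = (x < y).
Proof.
have [eta_ge0 _ _] := eta_exp.
have lt_eta a b : 0 <= a -> a < b -> eta a < eta b.
  move=> a0 ab; have b0 := le_trans a0 (ltW ab).
  rewrite ltNge; apply/negP => eba.
  have [|c /andP[c0 ca] /(expansive_inj c0 b0) cb] := @expansive_ivt a (eta b) a0.
    by rewrite eba eta_ge0.
  by move: ab; rewrite -cb ltNge ca.
move=> x0 y0; apply/idP/idP => [|/lt_eta]; last exact.
by apply: contraTT; rewrite -!leNgt le_eqVlt => /predU1P[->//|/(lt_eta _ _ y0)/ltW].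
Qed.

(** As [v <= eta v], a preimage of [v] exists in [[0, v]], so the partial inverse never falls back
    on its default value. *)
Lemma expansive_pinvK v : 0 <= v ->
  0 <= 'pinv_(fun=> 0) `[(0 : R), +oo[%classic eta v /\
  eta ('pinv_(fun=> 0) `[(0 : R), +oo[%classic eta v) = v.
Proof.
move=> v0; have [|c /andP[c0 _] <-] := @expansive_ivt v v v0.
  by rewrite v0 expansive_ge.
have c_in : c \in `[(0 : R), +oo[%classic by rewrite mem_setE in_itv /= c0.
rewrite pinvKV// => x y; rewrite !mem_setE !in_itv /= !andbT.
exact: expansive_inj.
Qed.

End Expansive.

Section MorseFlow.
Variable V : finType.
Implicit Types (G : morse_graph V) (v w x y : V).

(** The case [v = w] is excluded because the flow also returns [v] by default. *)
Lemma morse_flow_eq G v w : v != w ->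
  (morse_flow G v == w) = unique_maximal_edge G v (v, w) && lt_vertex G v w.
Proof.
move=> vw; rewrite /morse_flow; case: pickP => [u /andP[u_max uv]|/(_ w)->];
  last exact: negbTE.
apply/eqP/andP => [<-//|[/andP[w_max _] _]].
have /andP[_ /forallP/(_ (v, w))] := u_max.
by rewrite w_max => /eqP[].
Qed.

Lemma lt_vertex_morse_flow G v : morse_flow G v != v ->
  lt_vertex G v (morse_flow G v).
Proof.
by rewrite eq_sym => vw; have := morse_flow_eq G vw; rewrite eqxx => /esym/andP[].
Qed.

Lemma eq_morse_clustering G G' :
  morse_flow G =1 morse_flow G' -> morse_clustering G = morse_clustering G'.
Proof.
move=> eqGG'; rewrite /morse_clustering; congr equivalence_partition.
apply/funext => x; apply/funext => y; apply: eq_connect => u v.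
by rewrite /= /flow_edge /= !eqGG'.
Qed.

Lemma same_cluster_morse G x y : same_cluster (morse_clustering G) x y =
  connect [rel v w | flow_edge G v w || flow_edge G w v] x y.
Proof.
set e := [rel v w | _].
have e_sym : connect_sym e by apply: sym_connect_sym => u v /=; rewrite orbC.
apply/exists_inP/idP => [[C /imsetP[z _ ->]]|xy].
  rewrite !inE /= => /andP[zx zy]; apply: connect_trans zy.
  by rewrite e_sym.
exists [set z in [set: V] | connect e x z]; first by apply/imsetP; exists x.
by rewrite !inE connect0.
Qed.

Lemma same_cluster_morse_flow G v :
  same_cluster (morse_clustering G) v (morse_flow G v).
Proof.
rewrite same_cluster_morse; have [->|vw] := eqVneq (morse_flow G v) v.
  exact: connect0.
by apply: connect1; rewrite /= /flow_edge /= vw eqxx.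
Qed.

Lemma iter_morse_flow_le G k v : le_vertex G v (iter k (morse_flow G) v).
Proof.
elim: k v => [|k IHk] v; first exact: le_vertex_refl.
rewrite iterSr; apply: le_vertex_trans (IHk _).
have [->|/lt_vertex_morse_flow/andP[]//] := eqVneq (morse_flow G v) v.
exact: le_vertex_refl.
Qed.

Lemma fixed_point_max G v x : morse_flow G v = v ->
  same_cluster (morse_clustering G) v x -> le_vertex G x v.
Proof.
move=> v_fix; rewrite same_cluster_morse => /connectP[p].
(* Stronger invariant for the induction: every vertex on an undirected path from [v] flows into [v],
   and the flow never goes down in the vertex preorder. *)
suff to_v y : (exists k, iter k (morse_flow G) y = v) ->
    path [rel v w | flow_edge G v w || flow_edge G w v] y p -> x = last y p ->
    le_vertex G x v.
  by apply: to_v; exists 0%N.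
elim: p y => [|z p IHp] y [k yv] /=.
  by move=> _ ->; rewrite -yv; exact: iter_morse_flow_le.
move=> /andP[yz zp]; apply: IHp => //.
case/orP: yz => /andP[] => [yz /eqP <-|_ /eqP zy].
  (* For an edge followed along the flow, [k = 0] would make [y] the fixed point [v], which has no
     outgoing flow edge. *)
  case: k yv => [/= yv|k]; last by rewrite iterSr; exists k.
  by rewrite yv v_fix eqxx in yz.
by exists k.+1; rewrite iterSr zy.
Qed.

End MorseFlow.

(** Maximal edges lead to nearest neighbours; the inequality is strict because a tie would give a
    second maximal edge. *)
Lemma sir_unique_maximal_edgeP (R : realType) (X : finType) (n : nat)
    (lab : X -> 'I_n) (d : X -> X -> R) v w : v != w ->
  reflect (forall t, t != v -> t != w -> d v w < d v t)
    (unique_maximal_edge (sir_graph lab d) v (v, w)).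
Proof.
move=> vw.
have atP (f : X * X) : f \in edges_at (sir_graph lab d) v ->
    f = (v, f.2) /\ f.2 != v.
  by case: f => a b; rewrite !inE /= => /andP[ab /eqP <-]; rewrite eq_sym.
have in_at t : t != v -> (v, t) \in edges_at (sir_graph lab d) v.
  by move=> tv; rewrite !inE /= eq_sym tv eqxx.
apply: (iffP andP) => [[/andP[_ /forall_inP w_max] /forallP w_uniq] t tv tw|w_near].
  have /= /andP[_ wt] := w_max _ (in_at t tv).
  rewrite lt_neqAle wt andbT; apply/eqP => eq_wt.
  have: maximal_edge (sir_graph lab d) v (v, t).
    rewrite /maximal_edge in_at//=; apply/forall_inP => f f_at.
    have /andP[/= fv] := w_max _ f_at.
    by rewrite eq_wt => ft; apply/andP.
  by move=> /(implyP (w_uniq _))/eqP[/eqP]; rewrite (negbTE tw).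
have w_max : maximal_edge (sir_graph lab d) v (v, w).
  rewrite /maximal_edge in_at 1?eq_sym//=; apply/forall_inP => f /atP[-> fv].
  apply/andP; split=> //=; have [->//|fw] := eqVneq f.2 w.
  by apply/ltW/w_near.
split=> //; apply/forallP => f; apply/implyP => /andP[/atP[-> fv]].
move=> /forall_inP/(_ (v, w)); rewrite in_at 1?eq_sym// => /(_ isT)/andP[_ /= fw].
apply/eqP; congr pair; apply: contraTeq fw => fw.
by rewrite -ltNge; apply: w_near; rewrite // eq_sym.
Qed.

Theorem theorem15 (R : realType) (X : finType) (n : nat) (lab : X -> 'I_n)
    (hn : (3 <= n)%N) (hlab : bijective lab) :
  @monotonic_consistency R X (@sir_morse R X n lab).
Proof.
move=> d d_dist d' dd'; apply: eq_morse_clustering => v.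
set P := sir_morse lab d in dd'.
have [d'_dist [eta eta_exp etaE]] := dd'.
have d_ge0 x y : 0 <= d x y by have [_ + _] := d_dist; exact.
have d'_ge0 x y : 0 <= d' x y by have [_ + _] := d'_dist; exact.
have eta0 : eta 0 = 0.
  have [_ _ d_eq0] := d_dist; have [_ _ d'_eq0] := d'_dist.
  (* The diagonal pair lies in one cluster, so [0 = d v v = eta (d' v v) = eta 0]. *)
  have [+ _] := etaE v v; rewrite same_cluster_morse connect0 => /(_ isT).
  by rewrite (iffRL (d_eq0 v v))// (iffRL (d'_eq0 v v)).
have inP x y : same_cluster P x y -> d x y = eta (d' x y).
  by have [] := etaE x y.
have outP x y : ~~ same_cluster P x y -> d' x y = eta (d x y).
  by have [_ /[apply] ->] := etaE x y;
    have [] := expansive_pinvK eta_exp eta0 (d'_ge0 x y).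
have ge_in x y : same_cluster P x y -> d' x y <= d x y.
  by move=> /inP ->; exact: expansive_ge.
have le_out x y : ~~ same_cluster P x y -> d x y <= d' x y.
  by move=> /outP ->; exact: expansive_ge.
have vP := same_cluster_morse_flow (sir_graph lab d) v.
have [v_fix|] := eqVneq (morse_flow (sir_graph lab d) v) v.
  rewrite v_fix; apply/eqP/negPn/negP => v_move.
  set w := morse_flow _ v in v_move.
  have vw : v != w by rewrite eq_sym.
  have := morse_flow_eq (sir_graph lab d') vw; rewrite eqxx => /esym/andP[].
  move=> /(sir_unique_maximal_edgeP _ _ vw) w_near lt_vw.
  have wP : ~~ same_cluster P v w.
    apply/negP => /(fixed_point_max v_fix).
    by have /andP[_ /negP] := lt_vw.
  suff : morse_flow (sir_graph lab d) v == w by rewrite v_fix (negbTE vw).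
  rewrite morse_flow_eq//; apply/andP; split; last exact: lt_vw.
  apply/(sir_unique_maximal_edgeP _ _ vw) => t tv tw.
  (* For [t] in the cluster of [v]: [d v w <= d' v w < d' v t <= d v t]. Otherwise [eta] acts on
     both distances and preserves their order. *)
  have := w_near t tv tw; have [tP|tP] := boolP (same_cluster P v t).
    move=> lt_wt; apply: le_lt_trans (le_out _ _ wP) _.
    exact: lt_le_trans lt_wt (ge_in _ _ tP).
  by rewrite !outP// expansive_lt.
set w := morse_flow _ v in vP *; rewrite eq_sym => vw.
have := morse_flow_eq (sir_graph lab d) vw; rewrite eqxx => /esym/andP[].
move=> /(sir_unique_maximal_edgeP _ _ vw) w_near lt_vw.
apply/eqP; rewrite morse_flow_eq//; apply/andP; split; last exact: lt_vw.
apply/(sir_unique_maximal_edgeP _ _ vw) => t tv tw.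
(* The roles are exchanged: now [w] is in the cluster of [v], and for [t] outside it
   [d' v w <= d v w < d v t <= d' v t]. *)
have := w_near t tv tw; have [tP|tP] := boolP (same_cluster P v t).
  by rewrite !inP// expansive_lt.
move=> lt_wt; apply: le_lt_trans (ge_in _ _ vP) _.
exact: lt_le_trans lt_wt (le_out _ _ tP).
Qed.
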